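(* Let $$B=\begin{pmatrix} G_1 & E_1\\ E_2 & G_2\end{pmatrix}\quad\text{and}\quad \widetilde B=\begin{pmatrix} G_1 & O\\ O & G_2\end{pmatrix}$$ be complex $(m+n)\times(k+\ell)$ matrices, where $G_1$ is $m\times k$, $E_1$ is $m\times \ell$, $E_2$ is $n\times k$ and $G_2$ is $n\times\ell$, with singular values $$\sigma_1\ge\sigma_2\ge\cdots\ge\sigma_{\max\{m+n,k+\ell\}}\quad\text{and}\quad\widetilde\sigma_1\ge\widetilde\sigma_2\ge\cdots\ge\widetilde\sigma_{\max\{m+n,k+\ell\}},$$ respectively, so that $G_1$ and $G_2$ are non-trivial (that is, none of $m,n,k,\ell$ is zero). Define $\epsilon=\max\{\|E_1\|,\|E_2\|\}$, and $$\eta_i=\begin{cases}\min\limits_{\mu_2\in\sigma(G_2)}|\widetilde\sigma_i-\mu_2|, & \text{if }\widetilde\sigma_i\in\sigma(G_1),\\ \min\limits_{\mu_1\in\sigma(G_1)}|\widetilde\sigma_i-\mu_1|, & \text{if }\widetilde\sigma_i\in\sigma(G_2),\end{cases}$$ $$\eta=\min_{1\le i\le\min\{m+n,k+\ell\}}\eta_i=\min_{\mu_1\in\sigma(G_1),\,\mu_2\in\sigma(G_2)}|\mu_1-\mu_2|.$$ Then for $i=1,2,\dots,\min\{m+n,k+\ell\}$, $$|\sigma_i-\widetilde\sigma_i|\le\frac{2\epsilon^2}{\eta_i+\sqrt{\eta_i^2+4\epsilon^2}}\le\frac{2\epsilon^2}{\eta+\sqrt{\eta^2+4\epsilon^2}},$$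 and $\sigma_i=\widetilde\sigma_i=0$ for $i>\min\{m+n,k+\ell\}$.
   Context: For a complex $p\times q$ matrix $X$, the sequence of singular values is $\sigma(X)=(\sigma_1(X),\dots,\sigma_r(X))$ with $r=\max\{p,q\}$, where $\sigma_1(X)\ge\cdots\ge\sigma_r(X)$ are the nonnegative square roots of the eigenvalues of $XX^*$ or $X^*X$, whichever has the larger size. The notation $\mu\in\sigma(X)$ means that $\mu$ is an entry of this sequence. $X^*$ denotes the complex conjugate transpose of $X$, $\|Y\|$ denotes the spectral norm (largest singular value) of a matrix $Y$, and $O$ denotes a zero block.
   Formalization: The equality min η_i = min|μ_1−μ_2| fails for G_1=(5,0)^T, G_2=(1,0)^T (1 versus 0); it is proved unless both blocks are strictly tall or both strictly wide, with min|μ_1−μ_2| ≤ min η_i always, and the bounds are proved for both readings of η. *)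

(* Defs.v *)
From HB Require Import structures.
From mathcomp Require Import all_boot all_order all_algebra.
From mathcomp Require Import complex reals.
Set Implicit Arguments. Unset Strict Implicit. Unset Printing Implicit Defensive.
Import Order.TTheory GRing.Theory Num.Theory.
Local Open Scope ring_scope.
Local Open Scope sesquilinear_scope.

Section SingularValues.
Context {R : realType}.
Local Notation C := R[i].

(* The roots of the characteristic polynomial with multiplicity; their order
   in the sequence is unspecified. *)
Definition eigenvalues (d : nat) (A : 'M[C]_d) : seq C :=
  sval (closed_field_poly_normal (char_poly A)).

(* Non-increasing sequence of length maxn p q: the Gram matrix of the larger
   size is used, so the sequence of a non-square matrix is padded with zeros.
   The eigenvalues involved are real and nonnegative, so Re loses nothing. *)
Definition singular_values (p q : nat) (X : 'M[C]_(p, q)) : seq R :=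
  sort (fun x y => y <= x)
    [seq Num.sqrt (complex.Re z) |
       z <- if (q <= p)%N then eigenvalues (X *m X^t*)
            else eigenvalues (X^t* *m X)].

(* Indices start at 0: sigma_ X i is the (i+1)-st largest singular value. *)
Definition sigma_ (p q : nat) (X : 'M[C]_(p, q)) (i : nat) : R :=
  nth 0 (singular_values X) i.

Definition spectral_norm (p q : nat) (Y : 'M[C]_(p, q)) : R := sigma_ Y 0.

(* Intended for nonempty s; the value on [::] is 0. *)
Definition seq_min (s : seq R) : R := \big[Num.min/head 0 s]_(x <- s) x.

Definition block_diag (m n k l : nat) (G1 : 'M[C]_(m, k)) (G2 : 'M[C]_(n, l)) :
  'M[C]_(m + n, k + l) := block_mx G1 0 0 G2.

Section Gaps.
Variables (m n k l : nat) (G1 : 'M[C]_(m, k)) (G2 : 'M[C]_(n, l)).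

(* Each of the first minn (m + n) (k + l) singular values of block_diag G1 G2
   is a singular value of G1 or of G2, and if it is one of both then both
   branches are 0; hence a single test suffices. *)
Definition eta_ (i : nat) : R :=
  let s := sigma_ (block_diag G1 G2) i in
  if s \in singular_values G1
  then seq_min [seq `|s - mu2| | mu2 <- singular_values G2]
  else seq_min [seq `|s - mu1| | mu1 <- singular_values G1].

Definition eta_min : R :=
  seq_min [seq eta_ i | i <- iota 0 (minn (m + n) (k + l))].

(* This agrees with eta_min unless G1 and G2 are both strictly tall or both
   strictly wide. In that case 0 is a singular value of both, so sep = 0, while
   eta_min may be positive: for G1 = (5, 0)^T and G2 = (1, 0)^T, eta_min = 1. *)
Definition sep : R :=
  seq_min [seq `|mu1 - mu2| | mu1 <- singular_values G1,
                              mu2 <- singular_values G2].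

End Gaps.

(* When eps = eta = 0 the quotient is 0 / 0 = 0, the limit as eps tends to 0. *)
Definition quad_bound (eps eta : R) : R :=
  2 * eps ^+ 2 / (eta + Num.sqrt (eta ^+ 2 + 4 * eps ^+ 2)).

End SingularValues.

(* Main.v *)
Require Import Defs.
From HB Require Import structures.
From mathcomp Require Import all_boot all_order all_algebra.
From mathcomp Require Import complex reals.
From mathcomp Require Import ring lra zify.
Set Implicit Arguments. Unset Strict Implicit. Unset Printing Implicit Defensive.
Import Order.TTheory GRing.Theory Num.Theory.
Local Open Scope ring_scope.
Local Open Scope complex_scope.
Local Open Scope sesquilinear_scope.

(** The bound is an eigenvalue estimate for the Jordan-Wielandt matrix
    J(X) = [[0, X], [X*, 0]], which is Hermitian and whose positive eigenvalues
    are the positive singular values of X with the same multiplicities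
    ([count_spec_jw]): the spectrum of J(X) is symmetric about 0, and J(X)^2 is
    the direct sum of the two Gram matrices X X* and X* X.

    Split the coordinates of J(B) into those of G1 and those of G2. The two
    diagonal blocks are then J(G1) and J(G2), and the off-diagonal block
    [[0, E2], [E1*, 0]] has norm at most eps. Fix s = sigma_i(Bt), let the
    singular values of G1 and G2 stay at distances at least h1 >= 0 and h2 >= 0
    from s, and let de >= 0 satisfy (h1 + de) (h2 + de) >= eps^2. Take u in the
    sum of the eigenspaces of J(G1) for eigenvalues <= s, and v likewise for
    J(G2). The gaps push those eigenvalues down to s - h1 and s - h2, so the
    form of J(B) at u + v is at most
      (s - h1) |u|^2 + 2 eps |u| |v| + (s - h2) |v|^2
        <= (s + de) (|u|^2 + |v|^2),
    the last step being the arithmetic-geometric mean inequality. By the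
    Courant-Fischer principle J(B) has at least as many eigenvalues <= s + de
    as J(G1) and J(G2) together have eigenvalues <= s
    ([count_spec_compressions]). Passing to complements, B has no more singular
    values above s + de than Bt has above s, hence sigma_i(B) <= s + de. The same
    argument for - J(B) gives sigma_i(B) >= s - de when s > de, and for s <= de
    this holds because singular values are nonnegative.

    With gaps 0 and eta_i the best de solves de (eta_i + de) = eps^2, and its
    positive root is 2 eps^2 / (eta_i + sqrt (eta_i^2 + 4 eps^2)). It decreases
    in eta_i, whence the bounds with eta_min and sep.

    All spectral comparisons are equalities or inequalities between counts of
    list entries satisfying a predicate; [sigma_count] turns such a count into
    a statement about the i-th entry of the sorted list. *)

Section Perturbation.
Context {R : realType}.
Local Notation C := R[i].

(** * Spectra *)

Lemma char_poly_eigenvalues d (A : 'M[C]_d) :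
  char_poly A = \prod_(z <- eigenvalues A) ('X - z%:P).
Proof.
rewrite /eigenvalues; case: closed_field_poly_normal => s /= {1}->.
by rewrite (monicP (char_poly_monic A)) scale1r.
Qed.

Lemma size_eigenvalues d (A : 'M[C]_d) : size (eigenvalues A) = d.
Proof.
have := size_char_poly A.
by rewrite char_poly_eigenvalues size_prod_XsubC => -[].
Qed.

Lemma perm_eigenvalues d (A : 'M[C]_d) (s : seq C) :
  char_poly A = \prod_(z <- s) ('X - z%:P) -> perm_eq (eigenvalues A) s.
Proof. by rewrite char_poly_eigenvalues => /prod_XsubC_eq. Qed.

(** Both sides compute det [[X, A], [B, 1]] up to the same factor: eliminate B by
    a column operation, or by a row operation that multiplies the last n rows by
    X. *)
Lemma char_poly_mulmxC m n (A : 'M[C]_(m, n)) (B : 'M[C]_(n, m)) :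
  'X^n * char_poly (A *m B) = 'X^m * char_poly (B *m A).
Proof.
pose Ap := map_mx polyC A; pose Bp := map_mx polyC B.
pose M := block_mx ('X%:M : 'M_m) Ap Bp (1%:M : 'M_n).
have detR : \det M = char_poly (A *m B).
  have := det_mulmx M (block_mx 1%:M 0 (- Bp) 1%:M).
  rewrite det_lblock !det1 !mulr1 => <-.
  rewrite mulmx_block !mulmx1 !mulmx0 !mul1mx !add0r subrr det_ublock det1.
  by rewrite mulr1 mulmxN /char_poly /char_poly_mx map_mxM.
have detL : 'X^n * \det M = 'X^m * char_poly (B *m A).
  have := det_mulmx (block_mx (1%:M : 'M_m) 0 (- Bp) ('X%:M : 'M_n)) M.
  rewrite det_lblock det1 mul1r det_scalar => <-.
  rewrite mulmx_block !mulmx1 !mul1mx !mul0mx !addr0 mulNmx.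
  rewrite mul_scalar_mx mul_mx_scalar addNr det_ublock det_scalar.
  by rewrite mulNmx addrC /char_poly /char_poly_mx map_mxM.
by rewrite -detL detR.
Qed.

Lemma perm_eigenvalues_mulmxC m n (A : 'M[C]_(m, n)) (B : 'M[C]_(n, m)) :
  perm_eq (nseq n 0 ++ eigenvalues (A *m B)) (nseq m 0 ++ eigenvalues (B *m A)).
Proof.
apply: prod_XsubC_eq; rewrite !big_cat !big_nseq /= !iter_mulr_1 subr0.
by rewrite -!char_poly_eigenvalues char_poly_mulmxC.
Qed.

(** Taking A B and B A of the same size in [perm_eigenvalues_mulmxC] leaves
    nothing to pad. *)
Lemma perm_eigenvalues_similar n (A P Q : 'M[C]_n) :
  Q *m P = 1%:M -> perm_eq (eigenvalues (P *m A *m Q)) (eigenvalues A).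
Proof.
move=> QP; have := perm_eigenvalues_mulmxC (P *m A) Q.
by rewrite mulmxA QP mul1mx perm_cat2l.
Qed.

Lemma perm_eigenvalues_block_diag m n (A : 'M[C]_m) (D : 'M[C]_n) :
  perm_eq (eigenvalues (block_mx A 0 0 D)) (eigenvalues A ++ eigenvalues D).
Proof.
apply: perm_eigenvalues; rewrite big_cat /= -!char_poly_eigenvalues.
rewrite /char_poly /char_poly_mx map_block_mx scalar_mx_block opp_block_mx.
by rewrite add_block_mx !raddf0 !addr0 det_lblock.
Qed.

Lemma perm_eigenvalues_diag n (d : 'rV[C]_n) :
  perm_eq (eigenvalues (diag_mx d)) [seq d 0 i | i <- enum 'I_n].
Proof.
apply: perm_eigenvalues; rewrite char_poly_trig ?diag_mx_is_trig //.
rewrite big_map big_enum /=; apply: eq_bigr => i _.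
by rewrite mxE eqxx mulr1n.
Qed.

(** The real parts lose nothing for Hermitian matrices, the only ones to which
    this is applied; it makes counting with respect to the order of R possible. *)
Definition spec n (A : 'M[C]_n) : seq R :=
  [seq complex.Re z | z <- eigenvalues A].

Lemma size_spec n (A : 'M[C]_n) : size (spec A) = n.
Proof. by rewrite size_map size_eigenvalues. Qed.

Definition rdiag n (d : 'I_n -> R) : 'M[C]_n := diag_mx (\row_i (d i)%:C).

Lemma hermitian_diag n (A : 'M[C]_n) : A^t* = A ->
  exists U : 'M[C]_n, exists d : 'I_n -> R,
    U *m U^t* = 1%:M /\ A = U^t* *m rdiag d *m U.
Proof.
move=> hA; have hermA : A \is hermsymmx.
  by apply/is_hermitianmxP; rewrite expr0 scale1r hA.
have /orthomx_spectralP eA := hermitian_normalmx hermA.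
have dR := hermitian_spectral_diag_real hermA.
have Uu := spectral_unitarymx A.
exists (spectralmx A), (fun i => complex.Re (spectral_diag A 0 i)).
split; first exact/unitarymxP.
rewrite {1}eA invmx_unitary //; congr (_ *m diag_mx _ *m _).
apply/rowP => i; rewrite mxE RRe_real //.
by move/mxOverP: dR.
Qed.

Lemma perm_eigenvalues_conj_rdiag n (U : 'M[C]_n) (d : 'I_n -> R) :
  U *m U^t* = 1%:M ->
  perm_eq (eigenvalues (U^t* *m rdiag d *m U)) [seq (d i)%:C | i <- enum 'I_n].
Proof.
move=> UU; apply: perm_trans (perm_eigenvalues_similar _ UU) _.
apply: perm_trans (perm_eigenvalues_diag _) _.
by under eq_map do rewrite mxE.
Qed.

Lemma perm_spec_conj_rdiag n (U : 'M[C]_n) (d : 'I_n -> R) :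
  U *m U^t* = 1%:M -> perm_eq (spec (U^t* *m rdiag d *m U)) [seq d i | i <- enum 'I_n].
Proof.
move=> /(perm_eigenvalues_conj_rdiag d)/(perm_map (@complex.Re R)).
by rewrite -map_comp.
Qed.

Lemma perm_spec_opp n (A : 'M[C]_n) : A^t* = A ->
  perm_eq (spec (- A)) [seq - x | x <- spec A].
Proof.
move=> /hermitian_diag[U [d [UU ->]]].
have -> : - (U^t* *m rdiag d *m U) = U^t* *m rdiag (fun i => - d i) *m U.
  rewrite -mulNmx -mulmxN; congr (_ *m _ *m _).
  by apply/matrixP => i j; rewrite !mxE rmorphN mulNrn.
apply: perm_trans (perm_spec_conj_rdiag _ UU) _.
rewrite perm_sym; apply: perm_trans (perm_map _ (perm_spec_conj_rdiag _ UU)) _.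
by rewrite -map_comp.
Qed.

(** Together with [jw_sqr], this reads the singular values of X off the
    eigenvalues of its Jordan-Wielandt matrix. *)
Lemma perm_eigenvalues_sqr n (A : 'M[C]_n) : A^t* = A ->
  perm_eq (eigenvalues (A *m A)) [seq (x ^+ 2)%:C | x <- spec A].
Proof.
move=> /hermitian_diag[U [d [UU ->]]].
have -> : (U^t* *m rdiag d *m U) *m (U^t* *m rdiag d *m U) =
    U^t* *m rdiag (fun i => d i ^+ 2) *m U.
  rewrite !mulmxA mulmxtVK; last exact/unitarymxP.
  rewrite -!mulmxA; congr (_ *m _); rewrite mulmxA; congr (_ *m _).
  rewrite /rdiag mulmx_diag; congr diag_mx.
  by apply/rowP => i; rewrite !mxE -rmorphM.
apply: perm_trans (perm_eigenvalues_conj_rdiag _ UU) _.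
rewrite perm_sym; apply: perm_trans (perm_map _ (perm_spec_conj_rdiag _ UU)) _.
by rewrite -map_comp.
Qed.

(** * Hermitian forms and counting of eigenvalues *)

Lemma ReD (x y : C) : complex.Re (x + y) = complex.Re x + complex.Re y.
Proof. by case: x; case: y. Qed.

Lemma Re_conj (x : C) : complex.Re (Num.conj x) = complex.Re x.
Proof. by case: x. Qed.

Lemma Re_realM (a : R) (x : C) : complex.Re (a%:C * x) = a * complex.Re x.
Proof. by case: x => u v /=; rewrite mul0r subr0. Qed.

Definition redot n (x y : 'rV[C]_n) : R := complex.Re ((x *m y^t*) 0 0).
Definition normsq n (x : 'rV[C]_n) : R := redot x x.
Definition qform n (A : 'M[C]_n) (x : 'rV[C]_n) : R := redot (x *m A) x.

Lemma trmxC_mul m n p (A : 'M[C]_(m, n)) (B : 'M[C]_(n, p)) :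
  (A *m B)^t* = B^t* *m A^t*.
Proof. by rewrite trmx_mul map_mxM. Qed.

Lemma trmxCN m n (A : 'M[C]_(m, n)) : (- A)^t* = - A^t*.
Proof. by rewrite linearN map_mxN. Qed.

Lemma redotDl n (x y z : 'rV[C]_n) : redot (x + y) z = redot x z + redot y z.
Proof. by rewrite /redot mulmxDl mxE ReD. Qed.

Lemma redotE n (x y : 'rV[C]_n) :
  redot x y = \sum_i complex.Re (x 0 i * Num.conj (y 0 i)).
Proof.
rewrite /redot mxE (big_morph (@complex.Re R) (id1 := 0) (op1 := +%R)) //=.
  by apply: eq_bigr => i _; rewrite !mxE.
exact: ReD.
Qed.

Lemma redotC n (x y : 'rV[C]_n) : redot x y = redot y x.
Proof.
rewrite !redotE; apply: eq_bigr => i _.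
by rewrite -Re_conj rmorphM /= conjCK mulrC.
Qed.

Lemma redotDr n (x y z : 'rV[C]_n) : redot z (x + y) = redot z x + redot z y.
Proof. by rewrite redotC redotDl !(redotC z). Qed.

Lemma redotZl n (a : R) (x y : 'rV[C]_n) : redot (a%:C *: x) y = a * redot x y.
Proof. by rewrite /redot -scalemxAl mxE Re_realM. Qed.

Lemma redotZr n (a : R) (x y : 'rV[C]_n) : redot x (a%:C *: y) = a * redot x y.
Proof. by rewrite redotC redotZl redotC. Qed.

Lemma Re_mul_conj_ge0 (z : C) : 0 <= complex.Re (z * Num.conj z).
Proof. by case: z => a b /=; rewrite mulrN opprK addr_ge0 ?sqr_ge0. Qed.

Lemma normsq_ge0 n (x : 'rV[C]_n) : 0 <= normsq x.
Proof.
by rewrite /normsq redotE sumr_ge0 // => i _; exact: Re_mul_conj_ge0.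
Qed.

Lemma normsq_eq0 n (x : 'rV[C]_n) : (normsq x == 0) = (x == 0).
Proof.
apply/eqP/eqP => [|->]; last by rewrite /normsq /redot mul0mx mxE.
rewrite /normsq redotE => /eqP; rewrite psumr_eq0; last first.
  by move=> i _; exact: Re_mul_conj_ge0.
move=> /allP x0; apply/rowP => i; rewrite mxE.
have /= := x0 i (mem_index_enum _); case: (x 0 i) => a b /=.
rewrite mulrN opprK paddr_eq0 ?sqr_ge0 // -!expr2 !sqrf_eq0.
by case/andP=> /eqP -> /eqP ->.
Qed.

Lemma redot_isometry r n (Q : 'M[C]_(r, n)) (x y : 'rV[C]_r) :
  Q *m Q^t* = 1%:M -> redot (x *m Q) (y *m Q) = redot x y.
Proof.
by move=> QQ; rewrite /redot trmxC_mul mulmxA -(mulmxA x) QQ mulmx1.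
Qed.

Lemma qform_mulmx r n (Q : 'M[C]_(r, n)) (A : 'M[C]_n) (x : 'rV[C]_r) :
  qform A (x *m Q) = qform (Q *m A *m Q^t*) x.
Proof. by rewrite /qform /redot trmxC_mul !mulmxA. Qed.

Lemma qform_rdiag n (d : 'I_n -> R) (x : 'rV[C]_n) :
  qform (rdiag d) x = \sum_i d i * complex.Re (x 0 i * Num.conj (x 0 i)).
Proof.
rewrite /qform redotE; apply: eq_bigr => i _.
by rewrite mul_mx_diag !mxE -Re_realM mulrCA mulrA.
Qed.

Lemma qform_rdiag_le n (d : 'I_n -> R) t (x : 'rV[C]_n) :
  (forall i, d i <= t) -> qform (rdiag d) x <= t * normsq x.
Proof.
move=> dt; rewrite qform_rdiag /normsq redotE mulr_sumr ler_sum // => i _.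
by rewrite ler_wpM2r ?Re_mul_conj_ge0.
Qed.

Lemma qform_rdiag_gt n (d : 'I_n -> R) t (x : 'rV[C]_n) :
  (forall i, t < d i) -> x != 0 -> t * normsq x < qform (rdiag d) x.
Proof.
move=> dt x0; rewrite lt_neqAle; apply/andP; split; last first.
  rewrite qform_rdiag /normsq redotE mulr_sumr ler_sum // => i _.
  by rewrite ler_wpM2r ?Re_mul_conj_ge0 // ltW.
apply: contra x0; rewrite -normsq_eq0 eq_sym -subr_eq0.
rewrite qform_rdiag /normsq redotE mulr_sumr -sumrB => /eqP s0.
have {}s0 : \sum_i (d i - t) * complex.Re (x 0 i * Num.conj (x 0 i)) = 0.
  by rewrite -[RHS]s0; apply: eq_bigr => i _; rewrite mulrBl.
move/eqP: s0; rewrite psumr_eq0 => [/allP s0|i _]; last first.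
  by rewrite mulr_ge0 ?Re_mul_conj_ge0 // subr_ge0 ltW.
apply/eqP/big1 => i _; have /= := s0 i (mem_index_enum _).
by rewrite mulf_eq0 subr_eq0 gt_eqF //= => /eqP.
Qed.

(** The rows of Q are the rows of the diagonalizing unitary matrix whose
    eigenvalues satisfy P, so that u |-> u Q parametrizes the sum of the
    corresponding eigenspaces. *)
Lemma spectral_isometry n (A : 'M[C]_n) (P : pred R) : A^t* = A ->
  exists r (Q : 'M[C]_(r, n)) (d : 'I_r -> R),
    [/\ r = count P (spec A), Q *m Q^t* = 1%:M,
        Q *m A *m Q^t* = rdiag d & forall i, P (d i) /\ d i \in spec A].
Proof.
move=> /hermitian_diag[U [d [UU eA]]].
have pS : perm_eq (spec A) [seq d i | i <- enum 'I_n].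
  by rewrite eA perm_spec_conj_rdiag.
pose f := fun i : 'I_#|[pred i | P (d i)]| => enum_val i.
have fI : injective f by exact: enum_val_inj.
exists #|[pred i | P (d i)]|, (rowsub f U), (d \o f); split.
- rewrite (permP pS) count_map cardE size_filter -enumT.
  by apply: eq_count => i.
- rewrite rowsubE trmxC_mul mulmxA -(mulmxA _ U) UU mulmx1.
  apply/matrixP => i j; rewrite !mxE (bigD1 (f i)) //= big1 => [|k kf].
    by rewrite !mxE eqxx mul1r addr0 (inj_eq fI) eq_sym conjC_nat.
  by rewrite !mxE eq_sym (negPf kf) mul0r.
- have -> : rowsub f U *m A *m (rowsub f U)^t* =
            rowsub f 1%:M *m (U *m A *m U^t*) *m (rowsub f 1%:M)^t*.
    by rewrite rowsubE trmxC_mul !mulmxA.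
  rewrite eA !mulmxA -(mulmxA _ U) UU mulmx1 -(mulmxA _ U) UU mulmx1.
  apply/matrixP => i j; rewrite mxE (bigD1 (f j)) //= big1 => [|k kf]; last first.
    by rewrite !mxE eq_sym (negPf kf) conjC0 mulr0.
  rewrite !mxE eqxx conjC1 mulr1 addr0 (bigD1 (f i)) //= big1 => [|k kf].
    by rewrite !mxE eqxx mul1r addr0 (inj_eq fI).
  by rewrite !mxE eq_sym (negPf kf) mul0r.
- move=> i; split; first by have := enum_valP i; rewrite inE.
  by rewrite (perm_mem pS); apply/mapP; exists (f i); rewrite ?mem_enum.
Qed.

(** One half of the Courant-Fischer principle: the row space of S
    meets the sum of the eigenspaces for eigenvalues > t trivially, so the two
    dimensions add up to at most n. *)
Lemma isometry_le_count_spec r n (A : 'M[C]_n) (S : 'M[C]_(r, n)) (t : R) :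
  A^t* = A -> S *m S^t* = 1%:M ->
  (forall x, qform A (x *m S) <= t * normsq x) ->
  (r <= count (fun x => x <= t)%R (spec A))%N.
Proof.
move=> hA SS leS.
have [r' [Q [d [er' QQ QA dP]]]] := spectral_isometry (fun x => t < x) hA.
suff rr' : (r + r' <= n)%N.
  have := count_predC (fun x => x <= t) (spec A); rewrite size_spec => e.
  rewrite -(leq_add2r r') (leq_trans rr') // -[leqLHS]e leq_add2l er'.
  by apply: eq_leq; apply: eq_count => x /=; rewrite ltNge.
rewrite leqNgt; apply/negP => ltn.
(* If the dimensions added up to more than n, the rows of S and Q would be
   dependent, and a dependency gives a common nonzero vector x S = - y Q. *)
have : kermx (col_mx S Q) != 0.
  rewrite kermx_eq0 /row_free; apply/negP => /eqP e.
  by have := rank_leq_col (col_mx S Q); rewrite e leqNgt ltn.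
case/rowV0Pn => v /sub_kermxP; rewrite -[v]hsubmxK.
set x := lsubmx v; set y := rsubmx v; rewrite mul_row_col => xy v0.
have exy : x *m S = (- y) *m Q by rewrite mulNmx; apply/eqP; rewrite -addr_eq0 xy.
have nxy : normsq x = normsq (- y).
  by rewrite /normsq -(redot_isometry _ _ SS) exy redot_isometry.
have y0 : - y != 0.
  apply: contra v0 => y0; have x0 : x == 0.
    by rewrite -normsq_eq0 nxy normsq_eq0.
  by rewrite oppr_eq0 in y0; rewrite (eqP x0) (eqP y0) row_mx0.
have := leS x; rewrite exy qform_mulmx QA nxy leNgt qform_rdiag_gt // => i.
by case: (dP i).
Qed.

(** The weighted arithmetic-geometric mean inequality. It comes from expanding
    |al a - b K|^2 >= 0 and dividing by al; for al = 0 the bound on K forces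
    b K = 0. *)
Lemma redot_young n1 n2 (K : 'M[C]_(n2, n1)) (c al be : R) :
  (forall v, normsq (v *m K) <= c * normsq v) ->
  0 <= al -> 0 <= be -> c <= al * be ->
  forall a b, 2 * redot (b *m K) a <= al * normsq a + be * normsq b.
Proof.
move=> hK al0 be0 hc a b; have hw := hK b; set w := b *m K in hw *.
have {}hw : normsq w <= al * be * normsq b.
  by apply: le_trans hw _; rewrite ler_wpM2r ?normsq_ge0.
have [al0'|al_gt0] := eqVneq al 0.
  move: hw; rewrite al0' !mul0r => w0.
  have /eqP : normsq w == 0 by rewrite eq_le w0 normsq_ge0.
  move=> /eqP; rewrite normsq_eq0 => /eqP ->.
  by rewrite /redot mul0mx mxE mulr0 add0r mulr_ge0 ?normsq_ge0.
have {}al_gt0 : 0 < al by rewrite lt_neqAle eq_sym al_gt0.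
have := normsq_ge0 (al%:C *: a + (-1)%:C *: w).
rewrite /normsq redotDl !redotDr !redotZl !redotZr (redotC a w) => sq.
rewrite -subr_ge0 -(pmulr_rge0 _ al_gt0).
move: hw sq; rewrite /normsq; move: (redot w a) (redot w w) (redot a a) (redot b b).
by move=> *; nra.
Qed.

(** The count of eigenvalues <= t of A is bounded below through two orthogonal
    compressions: the spaces of eigenvectors of H1 and H2 for eigenvalues <= s
    span together a space on which the form of A is at most t, because the
    room al and be left below t by the gaps absorbs the coupling between W1 and
    W2. *)
Lemma count_spec_compressions n n1 n2 (A : 'M[C]_n)
    (W1 : 'M[C]_(n1, n)) (W2 : 'M[C]_(n2, n)) (c s t al be : R) :
  let H1 := W1 *m A *m W1^t* in
  let H2 := W2 *m A *m W2^t* in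
  A^t* = A -> W1 *m W1^t* = 1%:M -> W2 *m W2^t* = 1%:M -> W1 *m W2^t* = 0 ->
  (forall v, normsq (v *m (W2 *m A *m W1^t*)) <= c * normsq v) ->
  0 <= al -> 0 <= be -> c <= al * be ->
  {in spec H1, forall x, x <= s -> x <= t - al} ->
  {in spec H2, forall x, x <= s -> x <= t - be} ->
  (count (fun x => x <= s)%R (spec H1) + count (fun x => x <= s)%R (spec H2)
     <= count (fun x => x <= t)%R (spec A))%N.
Proof.
move=> H1 H2 hA W11 W22 W12 hK al0 be0 hc gap1 gap2.
have W21 : W2 *m W1^t* = 0.
  by rewrite -[W2 *m _]trmxCK trmxC_mul trmxCK W12 trmx0 map_mx0.
have herm r (W : 'M[C]_(r, n)) : (W *m A *m W^t*)^t* = W *m A *m W^t*.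
  by rewrite !trmxC_mul trmxCK hA mulmxA.
have [r1 [Q1 [d1 [<- QQ1 QA1 dP1]]]] :=
  spectral_isometry (fun x => x <= s) (herm _ W1).
have [r2 [Q2 [d2 [<- QQ2 QA2 dP2]]]] :=
  spectral_isometry (fun x => x <= s) (herm _ W2).
(* Orthogonality of W1 and W2 makes the stacked eigenvector bases an isometry. *)
apply: (isometry_le_count_spec (S := col_mx (Q1 *m W1) (Q2 *m W2)) hA).
  rewrite tr_col_mx map_row_mx mul_col_row !trmxC_mul !mulmxA.
  rewrite -!(mulmxA _ W1) -!(mulmxA _ W2) W11 W22 W12 W21 !mulmx0 !mul0mx !mulmx1.
  by rewrite QQ1 QQ2 scalar_mx_block.
move=> x; rewrite -[x]hsubmxK; set u := lsubmx x; set v := rsubmx x.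
rewrite mul_row_col !mulmxA; set a := u *m Q1; set b := v *m Q2.
have na : normsq a = normsq u by rewrite /normsq redot_isometry.
have nb : normsq b = normsq v by rewrite /normsq redot_isometry.
have -> : normsq (row_mx u v) = normsq a + normsq b.
  by rewrite na nb /normsq /redot tr_row_mx map_col_mx mul_row_col mxE ReD.
have -> : qform A (a *m W1 + b *m W2) =
   qform H1 a + qform H2 b + 2 * redot (b *m (W2 *m A *m W1^t*)) a.
  rewrite /qform mulmxDl redotDl !redotDr.
  have cross : redot (a *m W1 *m A) (b *m W2) = redot (b *m W2 *m A) (a *m W1).
    by rewrite redotC /redot !trmxC_mul hA !mulmxA.
  have e r1' r2' (W : 'M[C]_(r1', n)) (W' : 'M[C]_(r2', n)) p q :
    redot (p *m W *m A) (q *m W') = redot (p *m (W *m A *m W'^t*)) q.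
    by rewrite /redot trmxC_mul !mulmxA.
  by rewrite cross !e /H1 /H2 /qform; ring.
have young := redot_young hK al0 be0 hc a b.
have le1 : qform H1 a <= (t - al) * normsq a.
  rewrite na /a qform_mulmx QA1 qform_rdiag_le // => i.
  by case: (dP1 i) => ? ?; apply: gap1.
have le2 : qform H2 b <= (t - be) * normsq b.
  rewrite nb /b qform_mulmx QA2 qform_rdiag_le // => i.
  by case: (dP2 i) => ? ?; apply: gap2.
by move: young le1 le2; lra.
Qed.

(** * Singular values *)

Local Notation sqrts A := [seq Num.sqrt (complex.Re z) | z <- eigenvalues A].

Lemma perm_singular_values p q (X : 'M[C]_(p, q)) :
  perm_eq (singular_values X)
    (if (q <= p)%N then sqrts (X *m X^t*) else sqrts (X^t* *m X)).
Proof. by rewrite /singular_values perm_sort; case: ifP. Qed.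

Lemma size_singular_values p q (X : 'M[C]_(p, q)) :
  size (singular_values X) = maxn p q.
Proof.
rewrite (perm_size (perm_singular_values X)) /maxn.
by case: leqP => qp; rewrite size_map size_eigenvalues; case: ltngtP qp.
Qed.

Lemma singular_values_ge0 p q (X : 'M[C]_(p, q)) :
  {in singular_values X, forall x, 0 <= x}.
Proof.
move=> x; rewrite (perm_mem (perm_singular_values X)).
by case: ifP => _ /mapP[z _ ->]; rewrite sqrtr_ge0.
Qed.

Lemma sigma_ge0 p q (X : 'M[C]_(p, q)) i : 0 <= sigma_ X i.
Proof.
rewrite /sigma_; have [li|li] := ltnP i (size (singular_values X)).
  exact/singular_values_ge0/mem_nth.
by rewrite nth_default.
Qed.

(** The two Gram spectra differ by zeros only, and these are not counted when P
    holds for positive numbers only. This makes the choice of the larger Gram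
    matrix in the definition of singular values immaterial for such P. *)
Lemma count_sqrts_gramC p q (X : 'M[C]_(p, q)) (P : pred R) :
  (forall x, P x -> 0 < x) ->
  count P (sqrts (X *m X^t*)) = count P (sqrts (X^t* *m X)).
Proof.
move=> P0; have := perm_eigenvalues_mulmxC X (X^t*).
move=> /(perm_map (fun z => Num.sqrt (complex.Re z)))/permP/(_ P).
rewrite !map_cat !count_cat !map_nseq !count_nseq /= sqrtr0.
by have /negPf -> : ~~ P 0; [apply/negP => /P0; rewrite ltxx | rewrite !mul0n].
Qed.

Lemma count_singular_values p q (X : 'M[C]_(p, q)) (P : pred R) :
  (forall x, P x -> 0 < x) ->
  count P (singular_values X) = count P (sqrts (X *m X^t*)).
Proof.
move=> P0; rewrite (permP (perm_singular_values X)).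
by case: ifP => // _; rewrite count_sqrts_gramC.
Qed.

Lemma count_pos_singular_values_le p q (X : 'M[C]_(p, q)) :
  (count (fun x => 0 < x)%R (singular_values X) <= minn p q)%N.
Proof.
rewrite leq_min; apply/andP; split.
  rewrite count_singular_values // (leq_trans (count_size _ _)) //.
  by rewrite size_map size_eigenvalues.
rewrite count_singular_values // count_sqrts_gramC //.
by rewrite (leq_trans (count_size _ _)) // size_map size_eigenvalues.
Qed.

(** The larger Gram matrix, which defines the singular values, has every
    eigenvalue of the smaller one. *)
Lemma sqrt_eigenvalues_gram_sub p q (X : 'M[C]_(p, q)) :
  {subset sqrts (X *m X^t*) <= singular_values X} /\
  {subset sqrts (X^t* *m X) <= singular_values X}.
Proof.
have e := perm_eigenvalues_mulmxC X (X^t*).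
have pos (b : bool) r t c1 c2 : (r <= t -> b * t + c1 = b * r + c2 ->
    0 < c1 -> 0 < c2)%N by case: b; lia.
split=> _ /mapP[z zX ->]; rewrite (perm_mem (perm_singular_values X));
  case: (leqP q p) => pq; apply/mapP; exists z => //.
all: move/permP/(_ (pred1 z)): e; rewrite !count_cat !count_nseq.
all: move: zX; rewrite -!has_pred1 !has_count.
  move=> c0 e; apply: pos (ltnW pq) e c0.
move=> c0 e; apply: pos pq (esym e) c0.
Qed.

Lemma count_singular_values_block_diag m n k l
    (G1 : 'M[C]_(m, k)) (G2 : 'M[C]_(n, l)) (P : pred R) :
  (forall x, P x -> 0 < x) ->
  count P (singular_values (block_diag G1 G2)) =
    (count P (singular_values G1) + count P (singular_values G2))%N.
Proof.
move=> P0; rewrite !count_singular_values // -count_cat -map_cat.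
rewrite /block_diag tr_block_mx map_block_mx mulmx_block !trmx0 !map_mx0.
rewrite !mulmx0 !mul0mx !addr0 add0r.
by apply/permP/perm_map/perm_eigenvalues_block_diag.
Qed.

(** For a non-increasing list the entries satisfying an upward closed predicate
    form an initial segment. Indices beyond the list are covered, since the
    default value 0 fails P. *)
Lemma nth_sorted_count (s : seq R) (P : pred R) i :
  sorted (fun x y => y <= x) s -> ~~ P 0 ->
  (forall x y, P x -> x <= y -> P y) ->
  P (nth 0 s i) = (i < count P s)%N.
Proof.
move=> + P0 up; elim: s i => [|y s IHs] i /= sy.
  by rewrite nth_nil (negPf P0).
have tr : transitive (fun x y : R => y <= x) by move=> a b c /[swap]; apply: le_trans.
have [Py|nPy] := boolP (P y).
  by case: i => [|i] /=; rewrite ?Py // IHs ?(path_sorted sy).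
have le_y := order_path_min tr sy.
have -> : count P s = 0%N.
  apply/eqP; rewrite -leqn0 leqNgt -has_count; apply/hasPn => x xs.
  by apply: contra nPy => /up; apply; move/allP: le_y => /(_ x xs).
rewrite /= add0n; case: i => [|i] /=; first by rewrite (negPf nPy).
apply/negP => Px; have [li|li] := ltnP i (size s).
  by move/negP: nPy; apply; apply: up Px _; move/allP: le_y; apply; exact: mem_nth.
by move: Px; rewrite nth_default // (negPf P0).
Qed.

Lemma sorted_singular_values p q (X : 'M[C]_(p, q)) :
  sorted (fun x y => y <= x) (singular_values X).
Proof. by apply: sort_sorted => x y; exact: le_total. Qed.

Lemma sigma_count p q (X : 'M[C]_(p, q)) (P : pred R) i :
  (forall x, P x -> 0 < x) -> (forall x y, P x -> x <= y -> P y) ->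
  P (sigma_ X i) = (i < count P (singular_values X))%N.
Proof.
move=> P0 up; apply: nth_sorted_count => //; first exact: sorted_singular_values.
by apply/negP => /P0; rewrite ltxx.
Qed.

Lemma sigma_eq0 p q (X : 'M[C]_(p, q)) i : (minn p q <= i)%N -> sigma_ X i = 0.
Proof.
move=> li; apply/eqP; rewrite eq_le sigma_ge0 andbT leNgt.
rewrite (sigma_count _ (P := fun x => 0 < x)) //; last by move=> x y; exact: lt_le_trans.
by rewrite -leqNgt (leq_trans _ li) ?count_pos_singular_values_le.
Qed.

Lemma singular_value_le_spectral_norm p q (X : 'M[C]_(p, q)) :
  {in singular_values X, forall x, x <= spectral_norm X}.
Proof.
rewrite /spectral_norm /sigma_ => x; have := sorted_singular_values X.
case: singular_values => //= y s sy; rewrite inE => /predU1P[->//|xs].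
have tr : transitive (fun x y : R => y <= x) by move=> a b c /[swap]; apply: le_trans.
by move/allP: (order_path_min tr sy); apply.
Qed.

Lemma qform_le_spec n (A : 'M[C]_n) t (x : 'rV[C]_n) : A^t* = A ->
  {in spec A, forall a, a <= t} -> qform A x <= t * normsq x.
Proof.
move=> /hermitian_diag[U [d [UU eA]]] At.
have UU' : U^t* *m U = 1%:M by apply: mulmx1C.
have -> : normsq x = normsq (x *m U^t*).
  by rewrite /normsq redot_isometry // trmxCK.
have -> : qform A x = qform (rdiag d) (x *m U^t*).
  by rewrite qform_mulmx trmxCK -eA.
apply: qform_rdiag_le => i; apply: At.
by rewrite eA (perm_mem (perm_spec_conj_rdiag d UU)) map_f ?mem_enum.
Qed.

Lemma le_sqr_sqrtr (x : R) : x <= Num.sqrt x ^+ 2.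
Proof.
have [x0|/ltW x0] := leP 0 x; first by rewrite sqr_sqrtr.
exact: le_trans x0 (sqr_ge0 _).
Qed.

(** The squared norms |v X|^2 and |v X*|^2 are the forms of the Gram matrices
    X X* and X* X, whose eigenvalues are squares of singular values of X. *)
Lemma normsq_mulmx_le p q (X : 'M[C]_(p, q)) (e : R) :
  spectral_norm X <= e ->
  (forall v, normsq (v *m X) <= e ^+ 2 * normsq v) /\
  (forall v, normsq (v *m X^t*) <= e ^+ 2 * normsq v).
Proof.
move=> Xe; have [s1 s2] := sqrt_eigenvalues_gram_sub X.
have gram r (A : 'M[C]_r) : {subset sqrts A <= singular_values X} ->
    {in spec A, forall a, a <= e ^+ 2}.
  move=> sA a /mapP[z zA ->]; apply: le_trans (le_sqr_sqrtr _) _.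
  have zX : Num.sqrt (complex.Re z) \in singular_values X by apply/sA/map_f.
  rewrite lerXn2r ?nnegrE ?sqrtr_ge0 //.
    by apply: le_trans Xe; apply: sigma_ge0.
  exact: le_trans (singular_value_le_spectral_norm zX) Xe.
split=> v.
  have -> : normsq (v *m X) = qform (X *m X^t*) v.
    by rewrite /normsq /qform /redot trmxC_mul !mulmxA.
  by apply: qform_le_spec; [rewrite trmxC_mul trmxCK | exact: gram].
have -> : normsq (v *m X^t*) = qform (X^t* *m X) v.
  by rewrite /normsq /qform /redot trmxC_mul trmxCK !mulmxA.
by apply: qform_le_spec; [rewrite trmxC_mul trmxCK | exact: gram].
Qed.

(** * The Jordan-Wielandt matrix *)

Definition jw p q (X : 'M[C]_(p, q)) : 'M[C]_(p + q) := block_mx 0 X (X^t*) 0.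

Lemma jw_herm p q (X : 'M[C]_(p, q)) : (jw X)^t* = jw X.
Proof.
by rewrite /jw tr_block_mx map_block_mx trmxCK !trmx0 !map_mx0.
Qed.

Lemma jw_sqr p q (X : 'M[C]_(p, q)) :
  jw X *m jw X = block_mx (X *m X^t*) 0 0 (X^t* *m X).
Proof. by rewrite /jw mulmx_block !mulmx0 !mul0mx !addr0 !add0r. Qed.

(** Changing the sign of the last q coordinates is a unitary conjugation of
    J(X) into - J(X). *)
Lemma perm_spec_jw_opp p q (X : 'M[C]_(p, q)) :
  perm_eq (spec (jw X)) [seq - x | x <- spec (jw X)].
Proof.
pose D : 'M[C]_(p + q) := block_mx 1%:M 0 0 (- 1%:M).
have DD : D *m D = 1%:M.
  rewrite /D mulmx_block !mulmx0 !mul0mx !mul1mx !addr0 add0r.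
  by rewrite mulmxN mulmx1 opprK scalar_mx_block.
have eJ : D *m jw X *m D = - jw X.
  rewrite /D /jw !mulmx_block !mulmx0 !mul0mx !mul1mx !addr0 !add0r.
  by rewrite mulNmx mul1mx !mulmxN !mulmx1 opp_block_mx !oppr0 ?mul0mx ?oppr0.
apply: perm_trans (perm_spec_opp (jw_herm X)).
by rewrite -eJ perm_sym perm_map // perm_eigenvalues_similar.
Qed.

Lemma mem_spec_jw p q (X : 'M[C]_(p, q)) x :
  x \in spec (jw X) -> `|x| \in singular_values X.
Proof.
move=> xJ; have : (x ^+ 2)%:C \in eigenvalues (jw X *m jw X).
  rewrite (perm_mem (perm_eigenvalues_sqr (jw_herm X))).
  exact: (map_f (fun y => (y ^+ 2)%:C)).
rewrite jw_sqr (perm_mem (perm_eigenvalues_block_diag _ _)) mem_cat.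
have [s1 s2] := sqrt_eigenvalues_gram_sub X.
have e : `|x| = Num.sqrt (complex.Re (x ^+ 2)%:C) by rewrite sqrtr_sqr.
rewrite e => /orP[] h; [apply: s1 | apply: s2].
  exact: (map_f (fun z => Num.sqrt (complex.Re z))).
exact: (map_f (fun z => Num.sqrt (complex.Re z))).
Qed.

(** By symmetry, counting the eigenvalues of J(X) by absolute value counts twice
    those satisfying P. The same number counts the square roots of the
    eigenvalues of J(X)^2, hence the eigenvalues of both Gram matrices, which
    agree by [count_sqrts_gramC]. *)
Lemma count_spec_jw p q (X : 'M[C]_(p, q)) (P : pred R) :
  (forall x, P x -> 0 < x) ->
  count P (spec (jw X)) = count P (singular_values X).
Proof.
move=> P0; set L := spec (jw X).
have sym : count (fun x => P (- x)) L = count P L.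
  by rewrite [RHS](permP (perm_spec_jw_opp X)) [RHS]count_map.
have dbl : (count P L + count (fun x => P (- x)) L = count (fun x : R => P `|x|%R) L)%N.
  rewrite -count_predUI (eq_count (a1 := predI _ _) (a2 := pred0)) => [|x /=].
    rewrite count_pred0 addn0; apply: eq_count => x /=.
    have [x0|x0] := ger0P x; last first.
      have /negPf -> // : ~~ P x.
      by apply/negP => /P0; rewrite ltNge (ltW x0).
    have /negPf -> : ~~ P (- x).
      by apply/negP => /P0; rewrite oppr_gt0 ltNge x0.
    by rewrite orbF.
  apply/negP => /andP[/P0 x0 /P0]; rewrite oppr_gt0 ltNge (ltW x0) //.
have : count (fun x : R => P `|x|%R) L = count P (sqrts (jw X *m jw X)).
  rewrite [RHS]count_map [RHS](permP (perm_eigenvalues_sqr (jw_herm X))) [RHS]count_map.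
  by apply: eq_count => x /=; rewrite sqrtr_sqr.
rewrite -dbl sym jw_sqr.
have pe := perm_map (fun z => Num.sqrt (complex.Re z))
  (perm_eigenvalues_block_diag (X *m X^t*) (X^t* *m X)).
have eS := count_singular_values X P0.
rewrite addnn; move: (count P L) => c.
move/permP: pe => /(_ P) ->; rewrite map_cat count_cat.
by rewrite -(count_sqrts_gramC X P0) -eS addnn => /double_inj.
Qed.

(** * Perturbation of the off-diagonal blocks *)

Lemma normsq_row_mx p q (u : 'rV[C]_p) (v : 'rV[C]_q) :
  normsq (row_mx u v) = normsq u + normsq v.
Proof. by rewrite /normsq /redot tr_row_mx map_col_mx mul_row_col mxE ReD. Qed.

Section Blocks.
Variables (m n k l : nat).
Variables (G1 : 'M[C]_(m, k)) (E1 : 'M[C]_(m, l)).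
Variables (E2 : 'M[C]_(n, k)) (G2 : 'M[C]_(n, l)).
Let J := jw (block_mx G1 E1 E2 G2).

(** The coordinates of J = J(B) come in the order m, n, k, l, and
    [first_coords] and [second_coords] embed the coordinates of J(G1), in the
    order m, k, and those of J(G2), in the order n, l. *)
Definition first_coords : 'M[C]_(m + k, (m + n) + (k + l)) :=
  block_mx (row_mx 1%:M 0) 0 0 (row_mx 1%:M 0).
Definition second_coords : 'M[C]_(n + l, (m + n) + (k + l)) :=
  block_mx (row_mx 0 1%:M) 0 0 (row_mx 0 1%:M).
Local Notation W1 := first_coords.
Local Notation W2 := second_coords.

Let blockE := (tr_block_mx, map_block_mx, tr_row_mx, map_row_mx, tr_col_mx,
  map_col_mx, trmx1, map_mx1, trmx0, map_mx0, mulmx_block, mul_row_block,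
  mul_block_col, mul_row_col, mul_col_row, mulmx0, mul0mx, mul1mx, mulmx1, addr0, add0r).

Lemma first_coords_isometry : W1 *m W1^t* = 1%:M.
Proof. by rewrite /first_coords !blockE -scalar_mx_block. Qed.

Lemma second_coords_isometry : W2 *m W2^t* = 1%:M.
Proof. by rewrite /second_coords !blockE -scalar_mx_block. Qed.

Lemma first_second_coords0 : W1 *m W2^t* = 0.
Proof. by rewrite /first_coords /second_coords !blockE block_mx0. Qed.

Lemma jw_first_coords : W1 *m J *m W1^t* = jw G1.
Proof. by rewrite /first_coords /J /jw !blockE. Qed.

Lemma jw_second_coords : W2 *m J *m W2^t* = jw G2.
Proof. by rewrite /second_coords /J /jw !blockE. Qed.

Lemma jw_cross_coords :
  W2 *m J *m W1^t* = block_mx 0 E2 (E1^t*) 0.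
Proof. by rewrite /first_coords /second_coords /J /jw !blockE. Qed.

Lemma normsq_cross_le eps v :
  spectral_norm E1 <= eps -> spectral_norm E2 <= eps ->
  normsq (v *m (W2 *m J *m W1^t*)) <= eps ^+ 2 * normsq v.
Proof.
move=> /normsq_mulmx_le[_ le1] /normsq_mulmx_le[le2 _].
rewrite jw_cross_coords -[v]hsubmxK mul_row_block !mulmx0 add0r addr0.
by rewrite !normsq_row_mx mulrDr addrC lerD.
Qed.

Variables (s h1 h2 de eps : R).
Hypotheses (s_ge0 : 0 <= s) (h1_ge0 : 0 <= h1) (h2_ge0 : 0 <= h2) (de_ge0 : 0 <= de).
Hypotheses (E1_le : spectral_norm E1 <= eps) (E2_le : spectral_norm E2 <= eps).
Hypothesis eps_le : eps ^+ 2 <= (h1 + de) * (h2 + de).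
Hypothesis gap1 : {in singular_values G1, forall x, h1 <= `|s - x|}.
Hypothesis gap2 : {in singular_values G2, forall x, h2 <= `|s - x|}.

(** The gap is known for nonnegative singular values, while the eigenvalues of
    J(G) carry both signs. A negative eigenvalue - x with x >= 0 is even further
    from s >= 0 than x is. *)
Lemma spec_jw_below p q (G : 'M[C]_(p, q)) h :
  {in singular_values G, forall x, h <= `|s - x|} ->
  {in spec (jw G), forall x, x <= s -> x <= s - h}.
Proof.
move=> gap x /mem_spec_jw/gap + xs; move: s_ge0 => s0.
have [x0|x0] := ger0P x; first by rewrite ger0_norm ?subr_ge0 //; lra.
by rewrite opprK; have [?|?] := ger0P (s + x); lra.
Qed.

Lemma spec_jw_above p q (G : 'M[C]_(p, q)) h :
  {in singular_values G, forall x, h <= `|s - x|} ->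
  {in spec (jw G), forall x, s <= x -> s + h <= x}.
Proof.
move=> gap x /mem_spec_jw/gap + xs.
by rewrite (ger0_norm (le_trans s_ge0 xs)) ler0_norm ?subr_le0 //; lra.
Qed.

(** The compression bound counts eigenvalues below a threshold; since the
    compressions exhaust all coordinates, complements give the count above. *)
Lemma count_gt_perturb :
  (count (fun x => s + de < x)%R (singular_values (block_mx G1 E1 E2 G2)) <=
   count (fun x => s < x)%R (singular_values (block_diag G1 G2)))%N.
Proof.
have pos (t : R) (t0 : 0 <= t) x : t < x -> 0 < x by exact: le_lt_trans.
have sdpos : 0 <= s + de by rewrite addr_ge0.
rewrite (count_singular_values_block_diag G1 G2 (pos s s_ge0)).
rewrite -(count_spec_jw G1 (pos s s_ge0)) -(count_spec_jw G2 (pos s s_ge0)).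
rewrite -(count_spec_jw _ (pos _ sdpos)).
have := count_spec_compressions (A := J) (c := eps ^+ 2) (s := s)
  (t := s + de) (al := h1 + de) (be := h2 + de)
  (jw_herm _) first_coords_isometry second_coords_isometry first_second_coords0.
rewrite jw_first_coords jw_second_coords.
have below h x : (x <= s - h) -> x <= s + de - (h + de) by lra.
have H1 x xG xs := below _ _ (spec_jw_below gap1 (x := x) xG xs).
have H2 x xG xs := below _ _ (spec_jw_below gap2 (x := x) xG xs).
have nc v := normsq_cross_le v E1_le E2_le.
move=> /(_ nc (addr_ge0 h1_ge0 de_ge0) (addr_ge0 h2_ge0 de_ge0) eps_le H1 H2).
have compl (t : R) N (A : 'M[C]_N) :
    (count (fun x => x <= t)%R (spec A) + count (fun x => t < x)%R (spec A) = N)%N.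
  rewrite -{3}(size_spec A) -(count_predC (fun x => x <= t)).
  by congr (_ + _)%N; apply: eq_count => x /=; rewrite ltNge.
have arith (a1 b1 a2 b2 a b : nat) : (a1 + b1 = m + k -> a2 + b2 = n + l ->
  a + b = (m + n) + (k + l) -> a1 + a2 <= a -> b <= b1 + b2)%N by lia.
exact: arith (compl s _ (jw G1)) (compl s _ (jw G2)) (compl (s + de) _ J).
Qed.

(** The compression bound applied to - J. The threshold s - de has to be positive
    for the count in J(B) to be one of singular values. *)
Lemma count_ge_perturb : 0 < s - de ->
  (count (fun x => s <= x)%R (singular_values (block_diag G1 G2)) <=
   count (fun x => s - de <= x)%R (singular_values (block_mx G1 E1 E2 G2)))%N.
Proof.
move=> sd; have pos (t : R) (t0 : 0 < t) x : t <= x -> 0 < x by exact: lt_le_trans.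
have s_gt0 : 0 < s by apply: lt_le_trans sd _; rewrite gerBl.
rewrite (count_singular_values_block_diag G1 G2 (pos s s_gt0)).
rewrite -(count_spec_jw G1 (pos s s_gt0)) -(count_spec_jw G2 (pos s s_gt0)).
rewrite -(count_spec_jw _ (pos _ sd)).
have := count_spec_compressions (A := - J) (c := eps ^+ 2) (s := - s)
  (t := - (s - de)) (al := h1 + de) (be := h2 + de)
  _ first_coords_isometry second_coords_isometry first_second_coords0.
have negJ r r' (V : 'M[C]_(r, _)) (V' : 'M[C]_(r', _)) :
  V *m (- J) *m V'^t* = - (V *m J *m V'^t*) by rewrite mulmxN mulNmx.
rewrite !negJ jw_first_coords jw_second_coords trmxCN jw_herm.
have nc v : normsq (v *m - (W2 *m J *m W1^t*)) <= eps ^+ 2 * normsq v.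
  rewrite mulmxN -mulNmx; apply: le_trans (normsq_cross_le _ E1_le E2_le) _.
  rewrite /normsq -scaleN1r -(rmorphN1 (real_complex R)).
  by rewrite redotZl redotZr !mulN1r opprK.
have above p q (G : 'M[C]_(p, q)) h :
    {in singular_values G, forall x, h <= `|s - x|} ->
    {in spec (- jw G), forall x, x <= - s -> x <= - (s - de) - (h + de)}.
  move=> gap x; rewrite (perm_mem (perm_spec_opp (jw_herm G))) => /mapP[y yG ->].
  by rewrite lerN2 => /(spec_jw_above gap yG); lra.
move=> /(_ erefl nc (addr_ge0 h1_ge0 de_ge0) (addr_ge0 h2_ge0 de_ge0) eps_le
  (above _ _ _ _ gap1) (above _ _ _ _ gap2)).
have opp (t : R) p q (X : 'M[C]_(p, q)) :
    count (fun x => x <= - t)%R (spec (- jw X)) =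
    count (fun x => t <= x)%R (spec (jw X)).
  rewrite (permP (perm_spec_opp (jw_herm X))) [LHS]count_map.
  by apply: eq_count => x /=; rewrite lerN2.
by rewrite /J !opp.
Qed.

Lemma sigma_perturb i : s = sigma_ (block_diag G1 G2) i ->
  `|sigma_ (block_mx G1 E1 E2 G2) i - s| <= de.
Proof.
move=> es; rewrite ler_distl; apply/andP; split; last first.
  rewrite leNgt (sigma_count _ _ (P := fun x => s + de < x)); last 2 first.
  - by move=> x; apply: le_lt_trans; rewrite addr_ge0.
  - by move=> x y; exact: lt_le_trans.
  rewrite -leqNgt (leq_trans count_gt_perturb) // leqNgt.
  rewrite -(sigma_count _ _ (P := fun x => s < x)) -?es ?ltxx //.
  - by move=> x; exact: le_lt_trans.
  - by move=> x y; exact: lt_le_trans.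
have [sd|sd] := leP (s - de) 0; first exact: le_trans sd (sigma_ge0 _ _).
have s_gt0 : 0 < s by apply: lt_le_trans sd _; rewrite gerBl.
rewrite (sigma_count _ _ (P := fun x => s - de <= x)); last 2 first.
- by move=> x; exact: lt_le_trans.
- by move=> x y; exact: le_trans.
apply: leq_trans (count_ge_perturb sd).
rewrite -(sigma_count _ _ (P := fun x => s <= x)) -?es ?lexx //.
- by move=> x; exact: lt_le_trans.
- by move=> x y; exact: le_trans.
Qed.

End Blocks.

(** Rationalizing, quad_bound eps eta = (sqrt (eta^2 + 4 eps^2) - eta) / 2, the
    nonnegative root of x (eta + x) = eps^2; this is the equation that
    the parameter de of [sigma_perturb] has to satisfy. *)
Lemma quad_bound_eq (eps eta : R) : 0 <= eta ->
  0 <= quad_bound eps eta /\ quad_bound eps eta * (eta + quad_bound eps eta) = eps ^+ 2.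
Proof.
move=> eta0; rewrite /quad_bound; set S := Num.sqrt _.
have S0 : 0 <= S by exact: sqrtr_ge0.
have S2 : S ^+ 2 = eta ^+ 2 + 4 * eps ^+ 2.
  by rewrite sqr_sqrtr // addr_ge0 ?sqr_ge0 // mulr_ge0 ?sqr_ge0 ?ler0n.
split; first by rewrite divr_ge0 ?addr_ge0 // mulr_ge0 ?sqr_ge0.
have [->|eps0] := eqVneq eps 0; first by rewrite expr0n /= mulr0 !mul0r.
have e2 : 0 < eps ^+ 2 by rewrite lt_neqAle sqr_ge0 eq_sym sqrf_eq0 eps0.
have D0 : eta + S != 0.
  apply/negP => /eqP D0; have SN : S = - eta by lra.
  by move: S2; rewrite SN; nra.
(* In terms of S, both sides are rational functions without square roots. *)
have -> : eps ^+ 2 = (S ^+ 2 - eta ^+ 2) / 4 by rewrite S2; field.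
by field.
Qed.

Lemma le_quad_bound (eps eta eta' : R) : 0 <= eta' -> eta' <= eta ->
  quad_bound eps eta <= quad_bound eps eta'.
Proof.
move=> eta'0 le_eta; rewrite /quad_bound.
have [->|eps0] := eqVneq eps 0; first by rewrite expr0n /= mulr0 !mul0r.
have e2 : 0 < eps ^+ 2 by rewrite lt_neqAle sqr_ge0 eq_sym sqrf_eq0 eps0.
have S0 : 0 < Num.sqrt (eta' ^+ 2 + 4 * eps ^+ 2).
  by rewrite sqrtr_gt0 ltr_wpDl ?sqr_ge0 // mulr_gt0.
have D0 : 0 < eta' + Num.sqrt (eta' ^+ 2 + 4 * eps ^+ 2) by rewrite ltr_wpDl.
have leD : eta' + Num.sqrt (eta' ^+ 2 + 4 * eps ^+ 2) <=
           eta + Num.sqrt (eta ^+ 2 + 4 * eps ^+ 2).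
  by rewrite lerD // ler_wsqrtr // lerD2r lerXn2r // nnegrE (le_trans eta'0).
have num0 : 0 <= 2 * eps ^+ 2 by rewrite mulr_ge0 ?sqr_ge0 ?ler0n.
by rewrite ler_wpM2l // lef_pV2 // posrE (lt_le_trans D0 leD).
Qed.

(** * The gaps eta and sep *)

Lemma seq_min_le (s : seq R) x : x \in s -> seq_min s <= x.
Proof.
rewrite /seq_min; elim: s (head 0 s) => // y s IHs a.
rewrite inE big_cons => /predU1P[->|xs]; first by rewrite ge_min lexx.
by rewrite ge_min (IHs _ xs) orbT.
Qed.

Lemma mem_seq_min (s : seq R) : s != [::] -> seq_min s \in s.
Proof.
case: s => // a s _; suff H (t : seq R) : \big[Num.min/a]_(x <- t) x \in a :: t.
  by have := H (a :: s); rewrite inE => /predU1P[e|//]; rewrite /seq_min /= e mem_head.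
elim: t => [|y t IHt]; first by rewrite big_nil mem_head.
rewrite big_cons /Num.min; case: ifP => _; first by rewrite !inE eqxx orbT.
by move: IHt; rewrite !inE => /orP[->//|->]; rewrite !orbT.
Qed.

Lemma count_pos_all p q (X : 'M[C]_(p, q)) : 0 \notin singular_values X ->
  count (fun x => 0 < x)%R (singular_values X) = maxn p q.
Proof.
move=> X0; rewrite -(size_singular_values X); apply/eqP; rewrite -all_count.
apply/allP => x xX; rewrite lt_neqAle (singular_values_ge0 xX) andbT.
by apply: contraNneq X0 => ->.
Qed.

Lemma count_pos_lt p q (X : 'M[C]_(p, q)) : 0 \in singular_values X ->
  (count (fun x => 0 < x)%R (singular_values X) < maxn p q)%N.
Proof.
move=> X0; rewrite -(size_singular_values X) ltn_neqAle count_size andbT.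
by rewrite -all_count; apply/allPn; exists 0; rewrite ?ltxx.
Qed.

Lemma sigma_gt0 p q (X : 'M[C]_(p, q)) i :
  (0 < sigma_ X i) = (i < count (fun x => 0 < x)%R (singular_values X))%N.
Proof.
by rewrite (sigma_count _ _ (P := fun x => 0 < x)) // => x y; exact: lt_le_trans.
Qed.

Section Separation.
Variables (m n k l : nat) (G1 : 'M[C]_(m, k)) (G2 : 'M[C]_(n, l)).
Local Notation S1 := (singular_values G1).
Local Notation S2 := (singular_values G2).
Local Notation s i := (sigma_ (block_diag G1 G2) i).

Lemma mem_block_diag_pos x : 0 < x ->
  (x \in singular_values (block_diag G1 G2)) = (x \in S1) || (x \in S2).
Proof.
move=> x0; have pos y : y == x -> 0 < y by move=> /eqP ->.
rewrite -!has_pred1 !has_count.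
by rewrite (count_singular_values_block_diag G1 G2 pos) addn_gt0.
Qed.

Lemma count_pos_block_diag :
  count (fun x => 0 < x)%R (singular_values (block_diag G1 G2)) =
  (count (fun x => 0 < x)%R S1 + count (fun x => 0 < x)%R S2)%N.
Proof. exact: count_singular_values_block_diag. Qed.

(** For positive values this is [mem_block_diag_pos]. If sigma_i(Bt) = 0 but 0 is a
    singular value of neither block, then the blocks contribute
    max(m,k) + max(n,l) > i positive singular values, a contradiction. *)
Lemma sigma_block_diag_mem i : (i < minn (m + n) (k + l))%N ->
  (s i \in S1) || (s i \in S2).
Proof.
move=> li; have [s0|sn0] := eqVneq (s i) 0; last first.
  have s_gt0 : 0 < s i by rewrite lt_neqAle eq_sym sn0 sigma_ge0.
  rewrite -mem_block_diag_pos // mem_nth // size_singular_values.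
  by move: li; lia.
rewrite s0; apply/negPn/negP; rewrite negb_or => /andP[n1 n2].
have : 0 < s i.
  rewrite sigma_gt0 count_pos_block_diag (count_pos_all n1) (count_pos_all n2).
  by move: li; lia.
by rewrite s0 ltxx.
Qed.

Lemma eta_le_S1 i x : s i \in S1 -> x \in S2 -> eta_ G1 G2 i <= `|s i - x|.
Proof. by move=> si xS; rewrite /eta_ si; apply/seq_min_le/map_f. Qed.

(** When sigma_i(Bt) is a singular value of both blocks, eta_i is computed from G2
    and equals 0. *)
Lemma eta_le_S2 i x : s i \in S2 -> x \in S1 -> eta_ G1 G2 i <= `|s i - x|.
Proof.
move=> si xS; rewrite /eta_; case: ifP => si1; last exact/seq_min_le/map_f.
apply: (@le_trans _ _ `|s i - s i|); last by rewrite subrr normr0.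
exact/seq_min_le/map_f.
Qed.

Lemma sep_le x y : x \in S1 -> y \in S2 -> sep G1 G2 <= `|x - y|.
Proof. by move=> xS yS; apply/seq_min_le/allpairs_f. Qed.

Lemma eta_min_le i : (i < minn (m + n) (k + l))%N -> eta_min G1 G2 <= eta_ G1 G2 i.
Proof. by move=> li; apply/seq_min_le/map_f; rewrite mem_iota. Qed.

(** A positive value cannot sit at an index past min(m+n,k+l), where sigma_i
    vanishes. *)
Lemma pos_sigma_index x : 0 < x -> (x \in S1) || (x \in S2) ->
  exists2 i, (i < minn (m + n) (k + l))%N & s i = x.
Proof.
move=> x0; rewrite -mem_block_diag_pos // => /(nthP 0)[i li ex].
exists i => //; rewrite ltnNge; apply/negP => /(sigma_eq0 (block_diag G1 G2)) s0.
by move: x0; rewrite -ex -/(sigma_ _ i) s0 ltxx.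
Qed.

Hypotheses (m_gt0 : (0 < m)%N) (n_gt0 : (0 < n)%N).
Hypotheses (k_gt0 : (0 < k)%N) (l_gt0 : (0 < l)%N).

Let S1_nil : S1 != [::].
Proof. by rewrite -size_eq0 size_singular_values; lia. Qed.

Let S2_nil : S2 != [::].
Proof. by rewrite -size_eq0 size_singular_values; lia. Qed.

Lemma eta_attained i : exists x,
  eta_ G1 G2 i = `|s i - x| /\
  (s i \in S1 /\ x \in S2 \/ s i \notin S1 /\ x \in S1).
Proof.
rewrite /eta_; case: ifP => si.
  have : seq_min [seq `|s i - x| | x <- S2] \in [seq `|s i - x| | x <- S2].
    by apply: mem_seq_min; rewrite -size_eq0 size_map size_eq0.
  by case/mapP => x xS ->; exists x; split => //; left.
have : seq_min [seq `|s i - x| | x <- S1] \in [seq `|s i - x| | x <- S1].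
  by apply: mem_seq_min; rewrite -size_eq0 size_map size_eq0.
by case/mapP => x xS ->; exists x; split => //; right.
Qed.

Lemma eta_ge0 i : 0 <= eta_ G1 G2 i.
Proof. by have [x [-> _]] := eta_attained i. Qed.

Lemma sep_attained : exists x y, [/\ x \in S1, y \in S2 & sep G1 G2 = `|x - y|].
Proof.
have : sep G1 G2 \in [seq `|x - y| | x <- S1, y <- S2].
  apply: mem_seq_min; rewrite -size_eq0 size_allpairs muln_eq0.
  by rewrite !size_eq0 negb_or S1_nil S2_nil.
by case/allpairsP => -[x y] [? ? ->]; exists x, y.
Qed.

Lemma eta_min_attained : exists2 i, (i < minn (m + n) (k + l))%N &
  eta_min G1 G2 = eta_ G1 G2 i.
Proof.
have : eta_min G1 G2 \in [seq eta_ G1 G2 i | i <- iota 0 (minn (m + n) (k + l))].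
  by apply: mem_seq_min; rewrite -size_eq0 size_map size_iota; lia.
by case/mapP => i; rewrite mem_iota => li ->; exists i.
Qed.

Lemma sep_le_eta i : (i < minn (m + n) (k + l))%N -> sep G1 G2 <= eta_ G1 G2 i.
Proof.
move=> li; have [x [-> [[si xS]|[si xS]]]] := eta_attained i; first exact: sep_le.
have := sigma_block_diag_mem li; rewrite (negPf si) /= => si2.
by rewrite distrC sep_le.
Qed.

Lemma sep_le_eta_min : sep G1 G2 <= eta_min G1 G2.
Proof. by have [i li ->] := eta_min_attained; exact: sep_le_eta. Qed.

(** Let sep be attained at (x, y). If x or y is positive, it is some sigma_i(Bt)
    and eta_i <= |x - y|. If x = y = 0, then, unless both blocks are strictly
    tall or both strictly wide, the number c of positive singular values of Bt
    is smaller than min(m+n,k+l), so that sigma_c(Bt) = 0 has eta_c = 0. *)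
Lemma eta_min_eq_sep :
  ~~ (((k < m) && (l < n)) || ((m < k) && (n < l)))%N ->
  eta_min G1 G2 = sep G1 G2.
Proof.
move=> shape; apply: le_anti; rewrite sep_le_eta_min andbT.
have [x [y [xS yS ->]]] := sep_attained.
have [x0|xn0] := eqVneq x 0; last first.
  have x_gt0 : 0 < x by rewrite lt_neqAle eq_sym xn0 (singular_values_ge0 xS).
  have [|i li si] := pos_sigma_index x_gt0; first by rewrite xS.
  by apply: le_trans (eta_min_le li) _; rewrite -si eta_le_S1 // si.
have [y0|yn0] := eqVneq y 0; last first.
  have y_gt0 : 0 < y by rewrite lt_neqAle eq_sym yn0 (singular_values_ge0 yS).
  have [|i li si] := pos_sigma_index y_gt0; first by rewrite yS orbT.
  by apply: le_trans (eta_min_le li) _; rewrite distrC -si eta_le_S2 // si.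
rewrite x0 in xS; rewrite y0 in yS.
have lt_c : (count (fun x => 0 < x)%R (singular_values (block_diag G1 G2)) <
    minn (m + n) (k + l))%N.
  rewrite count_pos_block_diag.
  have := count_pos_lt xS; have := count_pos_lt yS.
  have := count_pos_singular_values_le G1; have := count_pos_singular_values_le G2.
  move: (count _ S1) (count _ S2) => c1 c2; move: shape; lia.
set c := count _ _ in lt_c.
have s0 : s c = 0.
  by apply/eqP; rewrite eq_le sigma_ge0 andbT leNgt sigma_gt0 ltnn.
apply: le_trans (eta_min_le lt_c) _.
by rewrite x0 y0 -{1}s0 eta_le_S1 // s0.
Qed.

End Separation.

End Perturbation.

Theorem theorem3 (R : realType) (m n k l : nat)
    (G1 : 'M[R[i]]_(m, k)) (E1 : 'M[R[i]]_(m, l))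
    (E2 : 'M[R[i]]_(n, k)) (G2 : 'M[R[i]]_(n, l))
    (m_gt0 : (0 < m)%N) (n_gt0 : (0 < n)%N)
    (k_gt0 : (0 < k)%N) (l_gt0 : (0 < l)%N) :
  let B := block_mx G1 E1 E2 G2 in
  let Bt := block_diag G1 G2 in
  let eps := Num.max (spectral_norm E1) (spectral_norm E2) in
  [/\ sep G1 G2 <= eta_min G1 G2,
      ~~ (((k < m) && (l < n)) || ((m < k) && (n < l)))%N ->
        eta_min G1 G2 = sep G1 G2,
      forall i : nat, (i < minn (m + n) (k + l))%N ->
        [/\ `|sigma_ B i - sigma_ Bt i| <= quad_bound eps (eta_ G1 G2 i),
            quad_bound eps (eta_ G1 G2 i) <= quad_bound eps (eta_min G1 G2) &
            quad_bound eps (eta_ G1 G2 i) <= quad_bound eps (sep G1 G2)] &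
      forall i : nat,
        (minn (m + n) (k + l) <= i < maxn (m + n) (k + l))%N ->
        sigma_ B i = 0 /\ sigma_ Bt i = 0].
Proof.
move=> B Bt eps; split.
- exact: sep_le_eta_min.
- exact: eta_min_eq_sep.
- move=> i li; split.
  + have eta0 : 0 <= eta_ G1 G2 i by exact: eta_ge0.
    have [de0 de_eq] := quad_bound_eq eps eta0.
    have E1e : spectral_norm E1 <= eps by rewrite le_max lexx.
    have E2e : spectral_norm E2 <= eps by rewrite le_max lexx orbT.
    have s0 : 0 <= sigma_ Bt i by exact: sigma_ge0.
    (* The block that contains sigma_i(Bt) gets gap 0, the other eta_i. *)
    have := sigma_block_diag_mem G1 G2 li.
    have [S1i _|_ /= S2i] := boolP (sigma_ Bt i \in singular_values G1).
      apply: (sigma_perturb (h1 := 0) (h2 := eta_ G1 G2 i) _ _ _ _ E1e E2e) => //.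
      * by rewrite add0r de_eq.
      * by move=> x; exact: eta_le_S1.
    apply: (sigma_perturb (h1 := eta_ G1 G2 i) (h2 := 0) _ _ _ _ E1e E2e) => //.
    * by rewrite add0r mulrC de_eq.
    * by move=> x; exact: eta_le_S2.
  + apply: le_quad_bound; last exact: eta_min_le.
    have [j _ ->] := eta_min_attained G1 G2 m_gt0 n_gt0 k_gt0 l_gt0; exact: eta_ge0.
  + apply: le_quad_bound; last exact: sep_le_eta.
    by have [x [y [_ _ ->]]] := sep_attained G1 G2 m_gt0 n_gt0 k_gt0 l_gt0.
- by move=> i /andP[li _]; rewrite !sigma_eq0.
Qed.
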